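(* Let $P$ be the transition function of an upward run chain on the poset $(S, \preceq)$, and let $\hat P$ be the transition function on the path space $\hat S$ whose only nonzero values are $$\hat P(a, ay) = P(x, y) \ (y \in A_x), \qquad \hat P(a, e) = P(x, e), \qquad a \in \hat S(x),\ x \in S.$$ If $\hat{\boldsymbol{X}} = (\hat X_0, \hat X_1, \ldots)$ is an upward run chain on $\hat S$ with transition function $\hat P$ and starting at $e$, then the process $\boldsymbol{X} = (X_0, X_1, \ldots)$ defined by $X_n = m(\hat X_n)$ is an upward run chain on $S$ with transition function $P$ and starting at $e$.
   Context: $(S, \preceq)$ is a discrete (countable) partially ordered set with a minimum element $e$, such that for every $x \in S$ every chain (totally ordered subset) in $S$ from $e$ to $x$ is finite. An element $y$ covers $x$ if $y$ is a minimal element of $\{t \in S : t \succ x\}$; $A_x = \{y \in S : y \text{ covers } x\}$. The covering graph is the directed graph on $S$ with an edge $(x,y)$ whenever $y$ covers $x$. An upward run chain on such a poset is a (time-homogeneous, discrete-time) Markov chain whose transition function $P$ satisfies $P(x,y) > 0$ if and only if $y \in A_x$ or $y = e$. Path space: $\hat S$ is the set of finite directed paths in the covering graph of $S$ starting at $e$, partially ordered by $a \preceq b$ iff $a$ is a prefix of $b$. Its minimum element is the degenerate path consisting only of $e$, also denoted $e$, and its covering graph is a tree rooted at $e$. For $a \in \hat S$, $m(a) \in S$ is the endpoint of $a$; $\hat S(x) = \{a \in \hat S : m(a) = x\}$; if $m(a)=x$ and $y$ covers $x$, then $ay$ is the path obtained by appending $y$ to $a$ (the elements covering $a$ in $\hat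 S$ are exactly these $ay$). *)

(* Defs.v *)
From HB Require Import structures.
From mathcomp Require Import all_boot all_order all_algebra.
From mathcomp Require Import all_classical all_reals all_analysis.

Set Implicit Arguments.
Unset Strict Implicit.
Unset Printing Implicit Defensive.

Import Order.TTheory GRing.Theory Num.Theory.

Local Open Scope classical_set_scope.
Local Open Scope ring_scope.

Section Poset.
Context {disp : Order.disp_t} {S : bPOrderType disp}.
Implicit Types x y t : S.

Definition chain_to x (C : set S) : Prop :=
  [/\ C \bot%O, C x, (forall t, C t -> (t <= x)%O) &
      total_on C (fun s t => (s <= t)%O)].

(* [y] is a minimal element of [set t | x < t] *)
Definition covers x y : bool :=
  `[< (x < y)%O /\ forall t, (x < t)%O -> (t <= y)%O -> t = y >].

End Poset.

(* The standing assumptions on (S, <=); the minimum element e is [\bot]. *)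
Definition discrete_poset {disp} (S : bPOrderType disp) : Prop :=
  countable [set: S] /\
  forall (x : S) (C : set S), chain_to x C -> finite_set C.

(* A path e = x_0, x_1, ..., x_n is stored as the sequence x_1, ..., x_n, so
   that the degenerate path is the empty sequence. *)
Record upath {disp} (S : bPOrderType disp) := UPath {
  upath_seq :> seq S;
  _ : path covers \bot%O upath_seq
}.

HB.instance Definition _ disp (S : bPOrderType disp) :=
  [isSub for @upath_seq disp S].
HB.instance Definition _ disp (S : bPOrderType disp) :=
  [Choice of upath S by <:].

Section PathSpace.
Context {disp : Order.disp_t} {S : bPOrderType disp}.
Implicit Types a b : upath S.

Definition upath_le a b : bool := prefix (val a) (val b).

Lemma upath_le_refl : reflexive upath_le.
Proof. by move=> a; apply: prefix_refl. Qed.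

Lemma upath_le_anti : antisymmetric upath_le.
Proof.
move=> a b /andP[/prefixP[s ab] /prefixP[t ba]]; apply/val_inj.
move: ba; rewrite ab -catA => /(congr1 size); rewrite !size_cat.
rewrite -[X in X = _]addn0 => /addnI /esym/eqP; rewrite addn_eq0.
by case/andP => /nilP -> _; rewrite cats0.
Qed.

Lemma upath_le_trans : transitive upath_le.
Proof. by move=> b a c; apply: prefix_trans. Qed.

Definition upath_bot : upath S := UPath (isT : path covers \bot%O [::]).

Lemma upath_le0x a : upath_le upath_bot a.
Proof. exact: prefix0s. Qed.

Definition endpoint a : S := last \bot%O (val a).

Lemma append_subproof a y : covers (endpoint a) y ->
  path covers \bot%O (rcons (val a) y).
Proof. by rewrite rcons_path => ->; rewrite andbT; case: a. Qed.

Definition append a y (h : covers (endpoint a) y) : upath S :=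
  UPath (append_subproof h).

End PathSpace.

Fact upath_display : Order.disp_t. Proof. exact: (Order.Disp tt tt). Qed.

HB.instance Definition _ disp (S : bPOrderType disp) :=
  Order.Le_isPOrder.Build upath_display (upath S)
    upath_le_refl upath_le_anti upath_le_trans.
HB.instance Definition _ disp (S : bPOrderType disp) :=
  Order.hasBottom.Build upath_display (upath S) upath_le0x.

Definition path_kernel {disp} {S : bPOrderType disp} {R : realType}
    (P : S -> S -> R) (a b : upath S) : R :=
  if b == \bot%O then P (endpoint a) \bot%O
  else if `[< exists y (h : covers (endpoint a) y), b = append h >]
  then P (endpoint a) (endpoint b)
  else 0.

Definition transition_function {S : choiceType} {R : realType}
    (P : S -> S -> R) : Prop :=
  (forall x y, 0 <= P x y) /\
  (forall x, \esum_(y in [set: S]) (P x y)%:E = 1%E).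

Definition upward_run_kernel {disp} {S : bPOrderType disp} {R : realType}
    (P : S -> S -> R) : Prop :=
  transition_function P /\
  (forall x y, 0 < P x y <-> covers x y \/ y = \bot%O).

Section Chains.
Context {d : measure_display} {Omega : measurableType d} {R : realType}.
Variable Pr : probability Omega R.

Definition cond_prob (A B : set Omega) : R :=
  fine (Pr (A `&` B)) / fine (Pr B).

Definition history {S : Type} (X : nat -> Omega -> S) (n : nat)
    (x : nat -> S) : set Omega :=
  [set w | forall k, (k <= n)%N -> X k w = x k].

(* The state space carries the discrete sigma-algebra. *)
Definition markov_chain {S : choiceType} (P : S -> S -> R)
    (X : nat -> Omega -> S) : Prop :=
  [/\ transition_function P,
      (forall n (A : set S), measurable (X n @^-1` A)) &
      forall n (x : nat -> S) (y : S), (0 < Pr (history X n x))%E ->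
        cond_prob (X n.+1 @^-1` [set y]) (history X n x) = P (x n) y].

Definition upward_run_chain {disp} {S : bPOrderType disp} (P : S -> S -> R)
    (X : nat -> Omega -> S) : Prop :=
  markov_chain P X /\ upward_run_kernel P.

Definition starts_at {S : Type} (X : nat -> Omega -> S) (x : S) : Prop :=
  Pr (X 0%N @^-1` [set x]) = 1%E.

End Chains.

Section Facts.
Context {disp : Order.disp_t} {S : bPOrderType disp}.

Lemma endpoint_bot : endpoint (\bot%O : upath S) = \bot%O.
Proof. by []. Qed.

Lemma endpoint_append (a : upath S) y (h : covers (endpoint a) y) :
  endpoint (append h) = y.
Proof. by rewrite /endpoint /= last_rcons. Qed.

Lemma append_neq_bot (a : upath S) y (h : covers (endpoint a) y) :
  (append h == \bot%O) = false.
Proof. by apply/negbTE/eqP => /(congr1 (size \o val)); rewrite /= size_rcons. Qed.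

Lemma covers_upath (a b : upath S) : covers a b <->
  exists y (h : covers (endpoint a) y), b = append h.
Proof.
split.
  move=> /asboolP[lab minb].
  have /prefixP[s bE] : prefix (val a) (val b) := ltW lab.
  case: s bE => [|y s] bE.
    by move: lab; rewrite (_ : a = b) ?ltxx//; apply/val_inj; rewrite bE cats0.
  have pb : path covers \bot%O (val b) by case: (b).
  move: pb; rewrite bE cat_path => /andP[_ /= /andP[ay _]].
  exists y, ay; apply/esym/minb.
    rewrite lt_neqAle; apply/andP; split; last exact: prefix_rcons.
    apply/eqP => /(congr1 (size \o val)) /=.
    by rewrite size_rcons => /n_Sn.
  by apply/prefixP; exists s; rewrite bE /= cat_rcons.
case=> y [h ->]; apply/asboolP; split.
  rewrite lt_neqAle; apply/andP; split; last exact: prefix_rcons.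
  apply/eqP => /(congr1 (size \o val)) /=.
  by rewrite size_rcons => /n_Sn.
move=> t lat lty.
have /prefixP[s tE] : prefix (val a) (val t) := ltW lat.
have /prefixP[u yE] : prefix (val t) (rcons (val a) y) := lty.
case: s tE => [|z s] tE.
  have at_eq : t = a by apply/val_inj; rewrite tE cats0.
  by move: lat; rewrite at_eq ltxx.
apply/val_inj => /=; move/eqP: yE.
rewrite tE -cats1 -catA eqseq_cat// eqxx /= eqseq_cons => /andP[/eqP ->].
by case: s tE.
Qed.

Lemma upath_discrete : discrete_poset S -> discrete_poset (upath S).
Proof.
case=> /countable_injP[f f_inj] _; split.
  apply/countable_injP; exists (fun a => pickle (map f (val a))) => a b _ _.
  move=> /(pcan_inj pickleK)/inj_map ab; apply/val_inj/ab => x y.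
  by apply: f_inj; rewrite inE.
move=> a C [_ _ Ca _].
have fin : finite_set [set` [seq take i (val a) | i <- iota 0 (size a).+1]].
  exact: finite_seq.
apply: (@sub_finite_set _ _ (val @^-1` [set` _]) _ (finite_preimage _ fin)).
  2: by move=> x y _ _; exact: val_inj.
move=> b Cb.
have ba : prefix (val b) (val a) := Ca b Cb.
apply/mapP; exists (size b); first by rewrite mem_iota /= ltnS size_prefix.
by move: ba; rewrite prefixE => /eqP ->.
Qed.

Context {R : realType}.
Variable P : S -> S -> R.

Lemma path_kernel_append (a : upath S) y (h : covers (endpoint a) y) :
  path_kernel P a (append h) = P (endpoint a) y.
Proof.
rewrite /path_kernel append_neq_bot asboolT; last by exists y, h.
by rewrite endpoint_append.
Qed.

Lemma path_kernel_bot (a : upath S) :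
  path_kernel P a \bot%O = P (endpoint a) \bot%O.
Proof. by rewrite /path_kernel eqxx. Qed.

Lemma path_kernel_eq0 (a b : upath S) : b <> \bot%O ->
  ~ (exists y (h : covers (endpoint a) y), b = append h) ->
  path_kernel P a b = 0.
Proof. by move=> /eqP/negbTE b0 /asboolF nb; rewrite /path_kernel b0 nb. Qed.

End Facts.

(* Main.v *)
Require Import Defs.
From HB Require Import structures.
From mathcomp Require Import all_boot all_order all_algebra.
From mathcomp Require Import all_classical all_reals all_analysis.

(** The endpoint map [m] makes the path-space chain lumpable: from a path [a]
    with endpoint [x], the total probability of moving to some path with
    endpoint [y] depends on [a] only through [x] and equals [P x y].  Indeed at
    most one path [b] with endpoint [y] is reachable from [a]: if [y] is the
    minimum, then [b] must be the degenerate path, because endpoints strictly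
    increase along a path; otherwise [b] must be [a] followed by [y], which is
    a path exactly when [y] covers [x], that is, exactly when [P x y] is
    nonzero ([esum_path_kernel_endpoint]).

    The conclusion then follows from Dynkin's criterion [lumped_markov_chain]:
    a function [f] of a Markov chain on a countable space is Markov as soon as
    the mass that the kernel sends from [a] to each fibre of [f] depends only
    on [f a].  Its proof splits the event that the image process has a given
    history into the countably many histories of the original chain that map
    onto it; on each of them the next-step probability is the same number, so
    it is also the probability on their union. *)

Set Implicit Arguments.
Unset Strict Implicit.
Unset Printing Implicit Defensive.

Import Order.TTheory GRing.Theory Num.Theory.

Local Open Scope classical_set_scope.
Local Open Scope ring_scope.
Local Open Scope ereal_scope.

(** * Sums and measures over countable fibres *)

Lemma ge0_esumZl (R : realType) (T : choiceType) (B : set T)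
    (a : T -> \bar R) (c : R) :
  (forall t, 0 <= a t) -> (0 <= c)%R ->
  \esum_(t in B) (c%:E * a t) = c%:E * \esum_(t in B) a t.
Proof.
move=> a0 c0; rewrite /esum -ereal_supZl//; last first.
  by apply/set0P; eexists; exists set0; [exact: fsets_set0|].
congr ereal_sup; rewrite image_comp.
by apply: eq_imagel => A _ /=; rewrite -ge0_mule_fsumr.
Qed.

Section Fibers.
Context {d : measure_display} {Omega : measurableType d} {R : realType}.
Variable mu : {measure set Omega -> \bar R}.

Lemma measure_fibers (T : choiceType) (Z : Omega -> T) (E : set Omega)
    (B : set T) : countable [set: T] ->
  (forall b, B b -> measurable (E `&` Z @^-1` [set b])) ->
  mu (E `&` Z @^-1` B) = \esum_(b in B) mu (E `&` Z @^-1` [set b]).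
Proof.
move=> /countable_injP[g g_inj] mE.
have gI : injective g by move=> s t; apply: g_inj; rewrite inE.
have gZ b : E `&` Z @^-1` [set b] = E `&` (g \o Z) @^-1` [set g b].
  by apply/seteqP; split=> w [Ew] /= => [->|/gI].
have -> : E `&` Z @^-1` B =
    \bigcup_(i in g @` B) (E `&` (g \o Z) @^-1` [set i]).
  apply/seteqP; split=> [w [Ew BZ]|w [_ [b Bb <-]] [Ew /gI /= Zb]].
    by exists (g (Z w)) => //; exists (Z w).
  by split => //=; rewrite Zb.
rewrite measure_bigcup.
- rewrite nneseries_esum// set_mem_set esum_image; last by move=> ? ? _ _ /gI.
  by apply: eq_esum => b _; rewrite gZ.
- by move=> _ [b Bb <-]; rewrite -gZ; exact: mE.
- by move=> i j _ _ [w [[_ /= <-] [_ /= <-]]].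
Qed.

End Fibers.

(** * Lumping a Markov chain *)

Section Lumping.
Context {d : measure_display} {Omega : measurableType d} {R : realType}.
Variable Pr : probability Omega R.

Lemma measurable_history (T : choiceType) (X : nat -> Omega -> T) n x :
  (forall k (A : set T), measurable (X k @^-1` A)) ->
  measurable (history X n x).
Proof.
move=> mX.
rewrite (_ : history X n x = \bigcap_(k in [set k | (k <= n)%N])
   X k @^-1` [set x k]); first by apply: bigcap_measurableType => k _.
by [].
Qed.

(** The product form of the Markov property has the advantage of remaining
    true for histories of probability zero. *)
Lemma markov_chainM (T : choiceType) (Q : T -> T -> R)
    (X : nat -> Omega -> T) n x b : markov_chain Pr Q X ->
  Pr (history X n x `&` X n.+1 @^-1` [set b]) =
  (Q (x n) b)%:E * Pr (history X n x).
Proof.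
case=> _ mX QX; have mH := measurable_history n x mX.
have mXH : measurable (X n.+1 @^-1` [set b] `&` history X n x).
  exact: measurableI.
rewrite setIC; have [H0|/eqP H0] := eqVneq (Pr (history X n x)) 0.
  by rewrite H0 mule0; apply: subset_measure0 H0 => //; exact: subIsetr.
have H_gt0 : 0 < Pr (history X n x).
  by rewrite lt0e measure_ge0 andbT; exact/eqP.
have := congr1 EFin (QX n x b H_gt0).
rewrite /cond_prob => <-.
rewrite -[in X in _ = _ * X](fineK (fin_num_measure Pr _ mH)) -EFinM divfK.
  by rewrite fineK// fin_num_measure.
by rewrite fine_eq0 ?fin_num_measure//; exact/eqP.
Qed.

(** Each history of the image chain is a countable disjoint union of histories
    of [X], and the hypothesis on the fibres of [f] gives all of them the same
    next-step probability [P (x n) y]. *)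
Lemma lumped_markov_chain (T S : choiceType) (f : T -> S)
    (Q : T -> T -> R) (P : S -> S -> R) (X : nat -> Omega -> T) :
  countable [set: T] -> transition_function P ->
  (forall a y, \esum_(b in f @^-1` [set y]) (Q a b)%:E = (P (f a) y)%:E) ->
  markov_chain Pr Q X -> markov_chain Pr P (fun n w => f (X n w)).
Proof.
move=> cT tP QP mcX; have [[Q0 _] mX _] := mcX.
split=> // [n A|n x y H_gt0]; first exact: (mX n (f @^-1` A)).
set Y := fun n w => f (X n w); set H := history Y n x.
have mH : measurable H.
  by apply: measurable_history => k A; exact: (mX k (f @^-1` A)).
(* On a single history of [X] the fibre of [y] has the required probability. *)
have atom t : f (t n) = x n ->
    Pr (history X n t `&` Y n.+1 @^-1` [set y]) =
    (P (x n) y)%:E * Pr (history X n t).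
  move=> ft; rewrite (measure_fibers _ (Z := X n.+1) (B := f @^-1` [set y]))//.
    rewrite -ft -QP muleC.
    rewrite -(fineK (fin_num_measure Pr _ (measurable_history n t mX))).
    rewrite -ge0_esumZl//.
    + apply: eq_esum => b _; apply: etrans (markov_chainM n t b mcX) _.
      rewrite muleC fineK// fin_num_measure//; exact: measurable_history.
    + by move=> b; rewrite lee_fin.
    + exact: fine_ge0.
  by move=> b _; apply: measurableI => //; exact: measurable_history.
have /countable_injP[g g_inj] := cT.
have gI : injective g by move=> s t; apply: g_inj; rewrite inE.
(* Infinite sequences of states are uncountably many, so the histories of [X]
   are indexed by the coded finite past [Z], with values in a countable type. *)
pose Z w := [seq g (X i w) | i <- iota 0 n.+1].
have ZE w w' : Z w = Z w' <-> forall k, (k <= n)%N -> X k w = X k w'.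
  split=> [/eq_in_map ZZ k kn|XX].
    by apply/gI/ZZ; rewrite mem_iota.
  by apply/eq_in_map => k; rewrite mem_iota ltnS => /XX ->.
have HZ z : H `&` Z @^-1` [set z] = set0 \/
    exists2 t, f (t n) = x n & H `&` Z @^-1` [set z] = history X n t.
  have [->|/set0P[w [Hw Zw]]] := eqVneq (H `&` Z @^-1` [set z]) set0.
    by left.
  right; exists (fun k => X k w); first exact: Hw.
  apply/seteqP; split=> [v [_ /= Zv] k kn|v vw].
    by have /ZE -> : Z v = Z w by rewrite Zv.
  split=> [k kn|/=]; first by rewrite /Y vw//; exact: Hw.
  by rewrite -Zw; apply/ZE.
have mHZ z : measurable (H `&` Z @^-1` [set z]).
  by case: (HZ z) => [->//|[t _ ->]]; exact: measurable_history.
have mY : measurable (Y n.+1 @^-1` [set y]).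
  exact: (mX n.+1 (f @^-1` [set y])).
have P0 : (0 <= P (x n) y)%R by case: tP.
have cZ : countable [set: seq nat] by exact: countableP.
have HP : Pr (Y n.+1 @^-1` [set y] `&` H) = (P (x n) y)%:E * Pr H.
  rewrite -[in RHS](setIT H) -[in LHS](setIT (_ `&` H)) -(preimage_setT Z).
  rewrite !measure_fibers//; last first.
    by move=> z _; rewrite -setIA; exact: measurableI.
  rewrite -ge0_esumZl//; apply: eq_esum => z _; rewrite -setIA.
  case: (HZ z) => [->|[t /atom Ht ->]]; first by rewrite setI0 measure0 mule0.
  by rewrite setIC.
rewrite /cond_prob HP fineM ?fin_num_measure// mulfK//.
by rewrite fine_eq0 ?fin_num_measure// gt_eqF.
Qed.

End Lumping.

(** * Endpoints in the path space *)

Section Endpoint.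
Context {disp : Order.disp_t} {S : bPOrderType disp}.

(** The last step of a nonempty path is a strict increase from an element above
    the minimum. *)
Lemma endpoint_eq_bot (a : upath S) : endpoint a = \bot%O <-> a = \bot%O.
Proof.
split=> [|->//]; case: a => s; case/lastP: s => [|s y] p.
  by move=> _; apply/val_inj.
rewrite /endpoint /= last_rcons => y0; exfalso.
have := p; rewrite rcons_path => /andP[_ /asboolP[+ _]].
by rewrite y0 ltx0.
Qed.

Lemma esum_path_kernel_endpoint {R : realType} (P : S -> S -> R) :
  upward_run_kernel P -> forall (a : upath S) (y : S),
  \esum_(b in endpoint @^-1` [set y]) (path_kernel P a b)%:E =
  (P (endpoint a) y)%:E.
Proof.
move=> [[P0 _] Ppos] a y.
have [->|y0] := eqVneq y \bot%O.
  rewrite (_ : endpoint @^-1` _ = [set \bot%O]).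
    by rewrite esum_set1 path_kernel_bot// lee_fin.
  by apply/seteqP; split=> b /endpoint_eq_bot.
have b_neq_bot b : endpoint b = y -> b <> \bot%O.
  by move=> by_ /endpoint_eq_bot; rewrite by_ => /eqP; rewrite (negPf y0).
have [h|nh] := boolP (covers (endpoint a) y).
  rewrite (esumID [set append h]); last first.
    move=> b _; rewrite lee_fin /path_kernel.
    by case: ifP => // _; case: ifP.
  rewrite [X in _ + X]esum1 ?adde0.
    rewrite setIidr; last by move=> _ -> /=; rewrite endpoint_append.
    by rewrite esum_set1 path_kernel_append// lee_fin.
  move=> b [/= bE nb]; rewrite path_kernel_eq0//; first exact: b_neq_bot.
  move=> [z [hz bz]]; apply: nb.
  move: bE; rewrite bz endpoint_append => zy; apply/val_inj => /=.
  by rewrite zy.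
have -> : P (endpoint a) y = 0%R.
  apply/eqP; rewrite eq_le P0 andbT leNgt; apply/negP => /Ppos[cay|/eqP].
    by rewrite cay in nh.
  by rewrite (negPf y0).
apply: esum1 => b /= bE; rewrite path_kernel_eq0//; first exact: b_neq_bot.
move=> [z [hz bz]]; move: bE; rewrite bz endpoint_append => zy.
by rewrite -zy hz in nh.
Qed.

End Endpoint.

Theorem proposition2 (disp : Order.disp_t) (S : bPOrderType disp)
    (hS : discrete_poset S) (R : realType) (P : S -> S -> R)
    (hP : upward_run_kernel P)
    (d : measure_display) (Omega : measurableType d) (Pr : probability Omega R)
    (Xhat : nat -> Omega -> upath S)
    (hX : upward_run_chain Pr (path_kernel P) Xhat)
    (hX0 : starts_at Pr Xhat (Order.bottom : upath S)) :
  upward_run_chain Pr P (fun n w => endpoint (Xhat n w)) /\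
  starts_at Pr (fun n w => endpoint (Xhat n w)) (Order.bottom : S).
Proof.
have [cU _] := upath_discrete hS; have [tP _] := hP; have [mcX _] := hX.
split.
  split=> //; apply: lumped_markov_chain mcX => //.
  exact: esum_path_kernel_endpoint.
rewrite /starts_at -hX0; congr (Pr _).
by apply/seteqP; split=> w /endpoint_eq_bot.
Qed.
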